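(* Let $\sigma\in\mathrm{Aut}_{\mathbb F}(A)$ and let $\mathcal C\subseteq\mathbb F[z]^n$ be a $\sigma$-cyclic convolutional code with generator polynomial $g\in A[z;\sigma]$. Then the following are equivalent: (i) $\mathcal C$ is minimal. (ii) $\mathcal C\ne\{0\}$ and $\mathcal C$ contains no proper $\sigma$-cyclic subcodes; precisely, if $\hat{\mathcal C}$ is a $\sigma$-cyclic convolutional code and $\{0\}\ne\hat{\mathcal C}\subseteq\mathcal C$, then $\hat{\mathcal C}=\mathcal C$. (iii) There exists a unit $u\in A[z;\sigma]$ such that $g=u^{(l)}$ for some index $l\in\{1,\ldots,r\}$.
   Context: $\mathbb F$ is a finite field and the length $n\ge1$ is coprime to $|\mathbb F|$. A convolutional code in $\mathbb F[z]^n$ is a submodule of the form $\{uG\mid u\in\mathbb F[z]^k\}$ with $G\in\mathbb F[z]^{k\times n}$ right invertible over $\mathbb F[z]$; equivalently, a direct summand of $\mathbb F[z]^n$. $A:=\mathbb F[x]/\langle x^n-1\rangle$ and $x^n-1=\pi_1\cdots\pi_r$ with monic irreducible pairwise different $\pi_i\in\mathbb F[x]$, ordered by nondecreasing degree. For $k=1,\ldots,r$, $\varepsilon^{(k)}\in A$ is the primitive idempotent with $\varepsilon^{(k)}\equiv\delta_{kj}\pmod{\pi_j}$ for all $j$. $\mathrm{Aut}_{\mathbb F}(A)$ is the group of $\mathbb F$-algebra automorphisms of $A$. $A[z;\sigma]$ is the skew-polynomial ring with elements $\sum_j z^ja_j$ ($a_j\in A$, coefficients on the right), usual addition, and multiplication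 determined by $az=z\sigma(a)$ for $a\in A$. For $g\in A[z;\sigma]$ let ${}^{\bullet}\langle g\rangle:=\{fg\mid f\in A[z;\sigma]\}$. Let $\mathfrak p:\mathbb F[z]^n\to A[z;\sigma]$ be the isomorphism of left $\mathbb F[z]$-modules $\sum_j z^jv_j\mapsto\sum_j z^j\mathfrak p(v_j)$, where $\mathfrak p(v_0,\ldots,v_{n-1})=\sum_i v_ix^i\bmod(x^n-1)$ on $\mathbb F^n$. A convolutional code $\mathcal C\subseteq\mathbb F[z]^n$ is $\sigma$-cyclic if $\mathfrak p(\mathcal C)$ is a left ideal of $A[z;\sigma]$. For $f\in A[z;\sigma]$ put $f^{(k)}:=\varepsilon^{(k)}f$. $f$ is called a component if $f=f^{(k)}$ for some $k$. Monomials are the elements $z^\mu\varepsilon^{(k)}$, ordered by $z^\mu\varepsilon^{(k)}<z^\nu\varepsilon^{(l)}$ iff $\mu<\nu$, or $\mu=\nu$ and $k<l$. The terms of $f=\sum_\nu z^\nu f_\nu$ are the elements $z^\nu\varepsilon^{(l)}f_\nu$; for $f\neq 0$, $LM(f)$ is the largest monomial $z^\mu\varepsilon^{(k)}$ with $\varepsilon^{(k)}f_\mu\ne0$. $f$ is reduced if for all $k\ne l$ (with $f^{(l)}\neq0$) no nonzero term of $f^{(k)}$ is right divisible by $LM(f^{(l)})$, i.e. equals $h\cdot LM(f^{(l)})$ with $h\in A[z;\sigma]$. It is known that for every $\sigma$-cyclic code $\mathcal C$ there is a reduced $g$, unique up to left multiplication by units of $A$, with $\mathfrak p(\mathcal C)={}^{\bullet}\langle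 g\rangle$; any such reduced $g$ is called a generator polynomial of $\mathcal C$. A $\sigma$-cyclic code $\mathcal C\ne\{0\}$ with generator polynomial $g$ is called minimal if $g$ is a component. *)

(* Defs.v *)
From HB Require Import structures.
From mathcomp Require Import all_boot all_order all_algebra.
From mathcomp Require Import classical_sets.
Set Implicit Arguments.
Unset Strict Implicit.
Unset Printing Implicit Defensive.
Import GRing.Theory.
Local Open Scope classical_set_scope.
Local Open Scope ring_scope.

(* The carrier is that of {poly R}: the coefficients, written on the right of  *)
(* the powers of z, are those of the underlying polynomial, but the            *)
(* multiplication is the one determined by a z = z sigma(a), so that           *)
(* (z^i a) (z^j b) = z^(i+j) (sigma^j(a) b).                                   *)
Definition skewpoly (R : nzRingType) (sigma : {rmorphism R -> R}) := {poly R}.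

HB.instance Definition _ (R : nzRingType) (sigma : {rmorphism R -> R}) :=
  GRing.Zmodule.copy (skewpoly sigma) {poly R}.

Section SkewRing.
Context (R : nzRingType) (sigma : {rmorphism R -> R}).
Local Notation S := (skewpoly sigma).
Implicit Types f g h : S.

Definition skew_coef f (j : nat) : R := (f : {poly R})`_j.

Definition skewC (a : R) : S := a%:P.
Definition skewZ : S := 'X : {poly R}.

Definition skew_mul f g : S :=
  \sum_(i < size (f : {poly R})) \sum_(j < size (g : {poly R}))
    ((iter j sigma (skew_coef f i) * skew_coef g j) *: 'X^(i + j) : {poly R}).

Let tw (j : nat) (p : {poly R}) : {poly R} := iter j (map_poly sigma) p.

Fact skew_twD j (p q : {poly R}) : tw j (p + q) = tw j p + tw j q.
Proof. by elim: j => //= j ->; rewrite rmorphD. Qed.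
Fact skew_tw0 j : tw j 0 = 0.
Proof. by elim: j => //= j ->; rewrite rmorph0. Qed.
Fact skew_twM j (p q : {poly R}) : tw j (p * q) = tw j p * tw j q.
Proof. by elim: j => //= j ->; rewrite rmorphM. Qed.
Fact skew_twC j (c : R) : tw j c%:P = (iter j sigma c)%:P.
Proof. by elim: j => //= j ->; rewrite map_polyC. Qed.
Fact skew_twXn j k : tw j 'X^k = 'X^k.
Proof. by elim: j => //= j ->; rewrite map_polyXn. Qed.
Fact skew_tw_coef j (p : {poly R}) i : (tw j p)`_i = iter j sigma p`_i.
Proof. by elim: j => //= j <-; rewrite coef_map. Qed.
Fact skew_tw_size j (p : {poly R}) : (size (tw j p) <= size p)%N.
Proof.
elim: j => //= j; apply: leq_trans; rewrite /map_poly; exact: size_poly.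
Qed.
Fact skew_twE j (p : {poly R}) :
  tw j p = \sum_(i < size p) (iter j sigma p`_i *: 'X^i).
Proof.
apply/polyP=> k; rewrite skew_tw_coef coef_sum.
under eq_bigr => i _ do rewrite coefZ coefXn.
case: (ltnP k (size p)) => hk.
  rewrite (bigD1 (Ordinal hk)) //= eqxx mulr1 big1 ?addr0 // => i ni.
  by rewrite -(inj_eq val_inj) /= eq_sym in ni; rewrite (negPf ni) mulr0.
rewrite -skew_tw_coef nth_default; last exact: leq_trans (skew_tw_size j p) hk.
rewrite big1 // => i _; have /negPf -> : k != i; last by rewrite mulr0.
by rewrite neq_ltn (leq_trans (ltn_ord i) hk) orbT.
Qed.

Fact skew_mulE (f g : {poly R}) N : (size g <= N)%N ->
  skew_mul f g = \sum_(j < N) tw j f * (g`_j)%:P * 'X^j :> {poly R}.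
Proof.
move=> hN; rewrite /skew_mul exchange_big /=.
rewrite (big_ord_widen N (fun j => \sum_(i < size f)
   ((iter j sigma (skew_coef f i) * skew_coef g j) *: 'X^(i + j) : {poly R}))) //.
rewrite big_mkcond; apply: eq_bigr => j _; rewrite skew_twE.
case: ltnP => [_|hj]; last by rewrite nth_default // polyC0 mulr0 mul0r.
rewrite !mulr_suml; apply: eq_bigr => i _.
rewrite /skew_coef exprD -!mul_polyC polyCM -!mulrA; congr (_ * _).
by rewrite !mulrA (commr_polyXn _ i).
Qed.

Fact skew_mulDl : left_distributive skew_mul +%R.
Proof.
move=> f1 f2 g; rewrite !(skew_mulE _ (leqnn _)) -big_split /=.
by apply: eq_bigr => j _; rewrite skew_twD !mulrDl.
Qed.

Fact skew_mulDr : right_distributive skew_mul +%R.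
Proof.
move=> f g1 g2.
set N := maxn (size (g1 : {poly R})) (size (g2 : {poly R})).
rewrite (@skew_mulE f g1 N) ?leq_maxl // (@skew_mulE f g2 N) ?leq_maxr //.
rewrite (@skew_mulE f _ N) ?size_polyD // -big_split /=.
by apply: eq_bigr => j _; rewrite coefD polyCD mulrDr mulrDl.
Qed.

Fact skew_mul0r f : skew_mul f 0 = 0.
Proof. by rewrite (@skew_mulE _ _ 0) ?size_poly0 // big_ord0. Qed.

Fact skew_mul_sumr f I (s : seq I) (G : I -> {poly R}) :
  skew_mul f (\sum_(i <- s) G i) = \sum_(i <- s) skew_mul f (G i) :> {poly R}.
Proof.
elim: s => [|i s IH]; first by rewrite !big_nil skew_mul0r.
by rewrite !big_cons -IH; apply: skew_mulDr.
Qed.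

Fact skew_mulCXn f c k :
  skew_mul f (c%:P * 'X^k : {poly R}) = tw k f * c%:P * 'X^k :> {poly R}.
Proof.
rewrite (@skew_mulE _ _ k.+1); last first.
  rewrite mul_polyC (leq_trans (size_scale_leq _ _)) //.
  by rewrite size_polyXn.
rewrite big_ord_recr /= big1 ?add0r => [|j _]; rewrite coefCM coefXn.
  by rewrite eqxx mulr1.
by rewrite ltn_eqF ?mulr0 ?polyC0 ?mulr0 ?mul0r.
Qed.

Fact skew_mulA : associative skew_mul.
Proof.
move=> f g h; rewrite (skew_mulE (skew_mul f g) (leqnn _)).
rewrite (skew_mulE g (leqnn _)) skew_mul_sumr.
apply: eq_bigr => j _; set c := _`_j.
rewrite (skew_mulE f (leqnn (size (g : {poly R})))).
rewrite skew_twE mulr_suml mulr_suml skew_mul_sumr.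
rewrite (big_morph (tw j) (skew_twD j) (skew_tw0 j)) mulr_suml mulr_suml.
apply: eq_bigr => i _.
have -> : iter j sigma (g : {poly R})`_i *: 'X^i * c%:P * 'X^j
   = (iter j sigma (g : {poly R})`_i * c)%:P * 'X^(i + j) :> {poly R}.
  rewrite -mul_polyC polyCM exprD -!mulrA; congr (_ * _).
  by rewrite !mulrA (commr_polyXn _ i).
rewrite skew_mulCXn !skew_twM skew_twXn skew_twC polyCM exprD.
rewrite /tw addnC iterD -!mulrA; congr (_ * (_ * _)).
by rewrite !mulrA (commr_polyXn _ i).
Qed.

Fact skew_mul1l : left_id (skewC 1) skew_mul.
Proof.
move=> f; rewrite (skew_mulE _ (leqnn _)) -[RHS]coefK poly_def.
apply: eq_bigr => j _; rewrite skew_twC.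
have -> : iter j sigma 1 = 1 by elim: (val j) => //= k ->; rewrite rmorph1.
by rewrite mul1r mul_polyC.
Qed.

Fact skew_mul1r : right_id (skewC 1) skew_mul.
Proof.
move=> f; rewrite (@skew_mulE _ _ 1) ?size_polyC ?oner_eq0 //.
by rewrite big_ord1 coefC /= !mulr1.
Qed.

Fact skew_oner_neq0 : skewC 1 != 0 :> S.
Proof. by rewrite /skewC (oner_neq0 {poly R}). Qed.

HB.instance Definition _ := GRing.Zmodule_isNzRing.Build S
  skew_mulA skew_mul1l skew_mul1r skew_mulDl skew_mulDr skew_oner_neq0.

Lemma skewC_Z (a : R) : skewC a * skewZ = skewZ * skewC (sigma a).
Proof.
rewrite [LHS](_ : _ = skew_mul (skewC a) (1%:P * 'X^1 : {poly R})); last first.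
  by rewrite mul1r expr1.
rewrite skew_mulCXn skew_twC [RHS](_ : _ =
  skew_mul skewZ ((sigma a)%:P * 'X^0 : {poly R})); last by rewrite expr0 mulr1.
by rewrite skew_mulCXn expr0 expr1 !mulr1 /= commr_polyX.
Qed.

Lemma skew_polyE f :
  f = \sum_(j < size (f : {poly R})) skewZ ^+ j * skewC (skew_coef f j).
Proof.
have ZE k : skewZ ^+ k = 'X^k :> {poly R}.
  elim: k => // k IH; rewrite exprSr [LHS](_ : _ =
    skew_mul (skewZ ^+ k) (1%:P * 'X^1 : {poly R})); last by rewrite mul1r expr1.
  by rewrite skew_mulCXn IH skew_twXn mulr1 -exprSr.
rewrite -[LHS]coefK poly_def; apply: eq_bigr => j _.
rewrite [RHS](_ : _ =
  skew_mul (skewZ ^+ j) ((skew_coef f j)%:P * 'X^0 : {poly R})); last first.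
  by rewrite expr0 mulr1.
by rewrite skew_mulCXn ZE expr0 mulr1 -commr_polyXn mul_polyC.
Qed.

End SkewRing.

Arguments skewC {R} sigma a.
Arguments skewZ {R} sigma.

Definition left_ideal (S : nzRingType) (I : set S) : Prop :=
  [/\ I 0, (forall f g, I f -> I g -> I (f + g))
    & (forall h f, I f -> I (h * f))].

Definition left_principal (S : nzRingType) (g : S) : set S :=
  [set f * g | f in [set: S]].

Definition right_divides (S : nzRingType) (m t : S) : Prop :=
  exists h : S, t = h * m.

Definition two_sided_unit (S : nzRingType) (u : S) : Prop :=
  exists v : S, u * v = 1 /\ v * u = 1.

Section Monomials.
Context (R : nzRingType) (sigma : {rmorphism R -> R}).
Context (r : nat) (eps : 'I_r -> R).
Local Notation S := (skewpoly sigma).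
Implicit Types f : S.

Definition skew_comp f (k : 'I_r) : S := skewC sigma (eps k) * f.

Definition is_component f : Prop := exists k : 'I_r, f = skew_comp f k.

Definition monomial (mu : nat) (k : 'I_r) : S :=
  skewZ sigma ^+ mu * skewC sigma (eps k).

Definition monomial_lt (mu : nat) (k : 'I_r) (nu : nat) (l : 'I_r) : bool :=
  (mu < nu)%N || (mu == nu) && (k < l)%N.

Definition skew_term f (nu : nat) (l : 'I_r) : S :=
  skewZ sigma ^+ nu * skewC sigma (eps l * skew_coef f nu).

(* LM(f) as a relation, so that no value has to be chosen for LM(0).           *)
Definition is_LM f (m : S) : Prop :=
  exists mu k, [/\ m = monomial mu k, eps k * skew_coef f mu != 0
    & forall nu l, eps l * skew_coef f nu != 0 ->
        (nu, l) = (mu, k) \/ monomial_lt nu l mu k].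

Definition reduced f : Prop :=
  forall (k l : 'I_r) (m : S), k != l ->
    skew_comp f l != 0 -> is_LM (skew_comp f l) m ->
    forall (nu : nat) (j : 'I_r), skew_term (skew_comp f k) nu j != 0 ->
      ~ right_divides m (skew_term (skew_comp f k) nu j).

End Monomials.

(* For n = 0 the library would quotient by 'X instead.                         *)
Notation cyclic_alg F n := {poly %/ ('X^n - 1 : {poly F})}.

(* The index k ranges over 'I_r, hence is shifted by one. The congruences are  *)
(* read on the canonical representative of eps k, which is harmless since      *)
(* every pi j divides 'X^n - 1; by the Chinese remainder theorem they          *)
(* determine eps.                                                              *)
Definition primitive_idempotents (F : fieldType) (n r : nat)
    (pi : 'I_r -> {poly F}) (eps : 'I_r -> cyclic_alg F n) : Prop :=
  forall k j : 'I_r,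
    pi j %| ((eps k : {poly F}) - ((k == j)%:R : {poly F})).

Definition conv_code (F : fieldType) (n : nat)
    (C : set 'rV[{poly F}]_n) : Prop :=
  exists (k : nat) (G : 'M[{poly F}]_(k, n)),
    (exists H : 'M[{poly F}]_(n, k), G *m H = 1%:M) /\
    C = [set u *m G | u in [set: 'rV[{poly F}]_k]].

Section CyclicCodes.
Context (F : fieldType) (n : nat).
Local Notation A := (cyclic_alg F n).
Context (sigma : {lrmorphism A -> A}).

Definition row_to_alg (v : 'rV[F]_n) : A := in_qpoly _ (rVpoly v).

Definition coef_row (j : nat) (v : 'rV[{poly F}]_n) : 'rV[F]_n :=
  \row_i (v 0 i)`_j.

Definition to_skew (v : 'rV[{poly F}]_n) : skewpoly sigma :=
  \sum_(j < \max_(i < n) size (v 0%R i))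
    skewZ sigma ^+ j * skewC sigma (row_to_alg (coef_row j v)).

Definition cyclic_code (C : set 'rV[{poly F}]_n) : Prop :=
  conv_code C /\ left_ideal (to_skew @` C).

Context (r : nat) (eps : 'I_r -> A).

Definition generator_poly (C : set 'rV[{poly F}]_n) (g : skewpoly sigma) :
    Prop :=
  reduced eps g /\ to_skew @` C = left_principal g.

Definition minimal_code (C : set 'rV[{poly F}]_n) : Prop :=
  [/\ cyclic_code C, C <> [set 0]
    & exists2 g, generator_poly C g & is_component eps g].

End CyclicCodes.

(* Main.v *)
Require Import Defs.
From mathcomp Require Import all_boot all_order all_algebra perm.
From mathcomp Require Import boolp classical_sets.
From mathcomp Require Import zify ring.
Set Implicit Arguments.
Unset Strict Implicit.
Unset Printing Implicit Defensive.
Import GRing.Theory.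
Local Open Scope classical_set_scope.
Local Open Scope ring_scope.

(** Torsion over F[z] decides everything: modulo any of its nonzero left
    multiples, a component [g = eps k * g] is torsion, whereas codes are exactly
    the submodules with torsion-free quotient.

    The ring A is the product of the fields [A * eps i], and [sigma] permutes
    the idempotents [eps i]. Hence the product of [f = f * eps k] and
    [h = eps k * h], both nonzero, has the expected degree although A[z;sigma]
    has zero divisors, and in the left module A[z;sigma] eps i one can divide on
    the right by any nonzero element ([right_division]). As A is finite, only
    finitely many remainders occur, so that [(z^s - z^t) * eps i] is a left
    multiple of [h = h * eps i] for some s < t ([torsion]). Convolutional codes
    are the submodules of F[z]^n that are saturated, that is, closed under
    removing nonzero polynomial factors ([conv_code_saturated],
    [saturated_conv_code]).

    From a component to the absence of subcodes: if a subcode contains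
    [f * g <> 0], torsion applied to [f * eps k] puts [(z^s - z^t) * g] in the
    subcode, and saturation then gives [g] itself ([component_no_subcode]).

    From the absence of subcodes to a component: in a reduced [g] the components
    have leading monomials with pairwise different idempotents, so their left
    multiples cannot cancel ([reduced_independent]). The left ideal of a nonzero
    component of [g] is therefore a direct summand of the one of [g], hence a
    code ([component_subcode]), hence everything.

    A component generating a code is a component of a unit: the row of products
    [g * eps i] is brought to a single nonzero entry by Euclid's algorithm,
    whose steps are right multiplications by the units [1 - c] with [c * c = 0]
    ([concentrate]). If that entry [h = h * eps i] generates a saturated left
    ideal, torsion makes [eps i] a left multiple of [h]; comparing degrees, [h]
    is a constant, which is a unit of the field [A * eps i]
    ([saturated_component_unit]). *)

(** * Coefficients of skew polynomials *)

Section SkewCoefficients.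
Context (R : nzRingType) (sigma : {rmorphism R -> R}).
Local Notation S := (skewpoly sigma).
Local Notation Z := (skewZ sigma).
Local Notation C := (skewC sigma).
Implicit Types f g h : S.

Definition ssize f := size (f : {poly R}).

Lemma skew_ext f g : skew_coef f =1 skew_coef g -> f = g.
Proof. by move=> fg; apply/polyP. Qed.

Lemma skew_coef0 k : skew_coef (0 : S) k = 0.
Proof. exact: coef0. Qed.

Lemma skew_coefD f g k : skew_coef (f + g) k = skew_coef f k + skew_coef g k.
Proof. exact: coefD. Qed.

Lemma skew_coefN f k : skew_coef (- f) k = - skew_coef f k.
Proof. exact: coefN. Qed.

Lemma skew_coefB f g k : skew_coef (f - g) k = skew_coef f k - skew_coef g k.
Proof. by rewrite skew_coefD skew_coefN. Qed.

Lemma skew_coef_sum I (s : seq I) (P : pred I) (f : I -> S) k :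
  skew_coef (\sum_(i <- s | P i) f i) k = \sum_(i <- s | P i) skew_coef (f i) k.
Proof.
by apply: (big_morph (fun f => skew_coef f k) (fun f g => skew_coefD f g k));
  exact: skew_coef0.
Qed.

Lemma skew_coefC a k : skew_coef (C a) k = a *+ (k == 0)%N.
Proof. by rewrite /skew_coef /skewC coefC; case: eqP. Qed.

Lemma ssize_leP f N :
  (forall k, (N <= k)%N -> skew_coef f k = 0) <-> (ssize f <= N)%N.
Proof. by split=> [/leq_sizeP|/leq_sizeP]. Qed.

Lemma ssize_eq0 f : (ssize f == 0)%N = (f == 0).
Proof. exact: size_poly_eq0. Qed.

Lemma skew_lead_neq0 f : f != 0 -> skew_coef f (ssize f).-1 != 0.
Proof. by rewrite -(lead_coef_eq0 (f : {poly R})) lead_coefE. Qed.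

Lemma skew_coef_neq0 f k : skew_coef f k != 0 -> (k < ssize f)%N.
Proof.
by apply: contraR; rewrite -leqNgt => kf; rewrite /skew_coef nth_default.
Qed.

Lemma tw_coef j (p : {poly R}) k :
  (iter j (map_poly sigma) p)`_k = iter j sigma p`_k.
Proof. exact: skew_tw_coef. Qed.

Lemma iter_sigmaM d a b : iter d sigma (a * b) = iter d sigma a * iter d sigma b.
Proof. by elim: d => //= d ->; rewrite rmorphM. Qed.

Lemma iter_sigma0 d : iter d sigma 0 = 0.
Proof. by elim: d => //= d ->; rewrite rmorph0. Qed.

Lemma iter_sigma1 d : iter d sigma 1 = 1.
Proof. by elim: d => //= d ->; rewrite rmorph1. Qed.

Lemma skew_coefM f g k :
  skew_coef (f * g) k =
    \sum_(j < k.+1) iter j sigma (skew_coef f (k - j)) * skew_coef g j.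
Proof.
rewrite /skew_coef.
rewrite [f * g](@skew_mulE _ _ f g (k.+1 + size (g : {poly R}))) ?leq_addl //.
rewrite coef_sum big_split_ord /= [X in _ + X]big1 ?addr0 => [|j _]; last first.
  by rewrite coefMXn ltnS leq_addr.
apply: eq_bigr => j _; rewrite coefMXn ltnNge -ltnS ltn_ord /=.
by rewrite coefMC tw_coef.
Qed.

Lemma skew_ZCE d a : Z ^+ d * C a = a%:P * 'X^d :> {poly R}.
Proof.
have ZE k : Z ^+ k = 'X^k :> {poly R}.
  elim: k => // k IH; rewrite exprSr [LHS](_ : _ =
    skew_mul (Z ^+ k) (1%:P * 'X^1 : {poly R})); last by rewrite mul1r expr1.
  by rewrite skew_mulCXn IH skew_twXn mulr1 -exprSr.
rewrite [LHS](_ : _ = skew_mul (Z ^+ d) (a%:P * 'X^0 : {poly R})); last first.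
  by rewrite expr0 mulr1.
by rewrite skew_mulCXn ZE expr0 mulr1 -commr_polyXn.
Qed.

Lemma skew_coefZC d a k : skew_coef (Z ^+ d * C a) k = a *+ (k == d).
Proof.
rewrite /skew_coef skew_ZCE coefCM coefXn.
by case: (k == d); rewrite ?mulr1 ?mulr0.
Qed.

Lemma skew_coefMZC f d a k :
  skew_coef (f * (Z ^+ d * C a)) k =
    if (k < d)%N then 0 else iter d sigma (skew_coef f (k - d)) * a.
Proof.
rewrite skew_coefM; case: ltnP => [kd|dk].
  rewrite big1 // => j _; rewrite skew_coefZC [_ == d]ltn_eqF ?mulr0 //.
  by rewrite (leq_ltn_trans _ kd) // -ltnS.
rewrite (bigD1 (Ordinal (dk : (d < k.+1)%N))) //= skew_coefZC eqxx big1 ?addr0 //.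
move=> j nj; rewrite skew_coefZC.
by rewrite -(inj_eq val_inj) /= in nj; rewrite (negPf nj) mulr0.
Qed.

Lemma skew_coefZCM f d a k :
  skew_coef (Z ^+ d * C a * f) k =
    if (k < d)%N then 0 else iter (k - d) sigma a * skew_coef f (k - d).
Proof.
rewrite skew_coefM; case: ltnP => [kd|dk].
  rewrite big1 // => j _; rewrite skew_coefZC ltn_eqF ?iter_sigma0 ?mul0r //.
  exact: leq_ltn_trans (leq_subr _ _) kd.
have lt : (k - d < k.+1)%N by rewrite ltnS leq_subr.
rewrite (bigD1 (Ordinal lt)) //= skew_coefZC subKn // eqxx big1 ?addr0 //.
move=> j nj; rewrite skew_coefZC; case: eqP => [e|_]; last first.
  by rewrite iter_sigma0 mul0r.
case/eqP: nj; apply: val_inj; rewrite /= -e subKn //.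
by rewrite -ltnS.
Qed.

Lemma skew_coefMC f a k : skew_coef (f * C a) k = skew_coef f k * a.
Proof. by have := skew_coefMZC f 0 a k; rewrite expr0 mul1r subn0. Qed.

Lemma skew_coefCM f a k : skew_coef (C a * f) k = iter k sigma a * skew_coef f k.
Proof. by have := skew_coefZCM f 0 a k; rewrite expr0 mul1r subn0. Qed.

Lemma skewCM a b : C (a * b) = C a * C b.
Proof.
apply: skew_ext => k; rewrite skew_coefMC !skew_coefC.
by case: (k == 0)%N; rewrite ?mul0r.
Qed.

Lemma skewCD a b : C (a + b) = C a + C b.
Proof. exact: polyCD. Qed.

Lemma skewC0 : C 0 = 0.
Proof. exact: polyC0. Qed.

Lemma skewC_sum I (s : seq I) (P : pred I) (a : I -> R) :
  C (\sum_(i <- s | P i) a i) = \sum_(i <- s | P i) C (a i).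
Proof. exact: (big_morph C skewCD skewC0). Qed.

Lemma skewC_CZ a d : C a * Z ^+ d = Z ^+ d * C (iter d sigma a).
Proof.
apply: skew_ext => k.
have -> : C a * Z ^+ d = C a * (Z ^+ d * C 1) by rewrite mulr1.
rewrite skew_coefMZC skew_coefZC mulr1 skew_coefC.
case: ltngtP => [||->]; rewrite ?subnn //= subn_eq0 => dk.
by rewrite leqNgt dk /= iter_sigma0.
Qed.

Lemma skewC_inj : injective C.
Proof. exact: polyC_inj. Qed.

Lemma skewC_neq0 a : a != 0 -> C a != 0.
Proof. by rewrite -(inj_eq skewC_inj) skewC0. Qed.

(** In top degree only one product of coefficients survives. *)
Lemma skew_coefM_top f g s t : (ssize f <= s.+1)%N -> (ssize g <= t.+1)%N ->
  skew_coef (f * g) (s + t) = iter t sigma (skew_coef f s) * skew_coef g t.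
Proof.
move=> /ssize_leP fs /ssize_leP gt; rewrite skew_coefM.
have lt : (t < (s + t).+1)%N by rewrite ltnS leq_addl.
rewrite (bigD1 (Ordinal lt)) //= addnK big1 ?addr0 // => j nj.
have {}nj : val j != t by rewrite -(inj_eq val_inj) /= in nj.
have [jt|tj] := ltnP j t; last by rewrite gt ?mulr0 // ltn_neqAle eq_sym nj.
by rewrite fs ?iter_sigma0 ?mul0r //; lia.
Qed.

Lemma ssizeM_leq f g : (ssize (f * g)%R <= (ssize f + ssize g).-1)%N.
Proof.
apply/ssize_leP => k hk; rewrite skew_coefM big1 // => j _.
have [jg|gj] := ltnP j (ssize g); last first.
  by rewrite [skew_coef g j]nth_default ?mulr0.
rewrite [skew_coef f _]nth_default ?iter_sigma0 ?mul0r //.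
have := ltn_ord j; rewrite -/(ssize f); lia.
Qed.

End SkewCoefficients.

Lemma left_principal_id (S : nzRingType) (g : S) : left_principal g g.
Proof. by exists 1; rewrite ?mul1r. Qed.

(** * Skew polynomials over a product of fields *)

Section Components.
Context (A : comNzRingType) (sigma : {rmorphism A -> A}).
Context (r : nat) (eps : 'I_r -> A).
Local Notation S := (skewpoly sigma).
Local Notation Z := (skewZ sigma).
Local Notation C := (skewC sigma).
Local Notation E i := (C (eps i)).
Implicit Types f g h : S.

(** [A] is the product of the fields [A * eps i]; the inverse in the last clause
    is taken with respect to [eps i], the identity of the factor. *)
Definition field_decomposition : Prop :=
  [/\ forall i j, eps i * eps j = eps i *+ (i == j),
      \sum_i eps i = 1,
      forall i, eps i != 0
    & forall i a, a * eps i != 0 -> exists b, b * (a * eps i) = eps i].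

Context (epsP : field_decomposition) (sigma_bij : bijective sigma).

Let epsM i j : eps i * eps j = eps i *+ (i == j). Proof. by case: epsP. Qed.
Let eps_sum : \sum_i eps i = 1. Proof. by case: epsP. Qed.
Let eps_neq0 i : eps i != 0. Proof. by case: epsP. Qed.
Let eps_field i a : a * eps i != 0 -> exists b, b * (a * eps i) = eps i.
Proof. by case: epsP => _ _ _; apply. Qed.

Let epsK i : eps i * eps i = eps i. Proof. by rewrite epsM eqxx. Qed.

Lemma iter_sigma_inj d : injective (iter d sigma).
Proof. by elim: d => [|d IH] x y //= /(bij_inj sigma_bij)/IH. Qed.

Lemma iter_sigma_onto d a : exists b, iter d sigma b = a.
Proof.
case: sigma_bij => si _ sK; exists (iter d si a).
by elim: d a => //= d IH a; rewrite -iterS iterSr sK.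
Qed.

Lemma iter_sigma_eq0 d a : (iter d sigma a == 0) = (a == 0).
Proof.
rewrite -[in LHS](iter_sigma0 sigma d); apply: inj_eq; exact: iter_sigma_inj.
Qed.

(** A field has no idempotents besides 0 and its identity. *)
Lemma idem_field i a : a * a = a -> a * eps i != 0 -> a * eps i = eps i.
Proof.
move=> aa /eps_field [b bE].
by rewrite -{1}bE mulrCA [X in b * X]mulrA aa bE.
Qed.

Lemma eps_separate a : (forall i, a * eps i = 0) -> a = 0.
Proof.
by move=> a0; rewrite -[a]mulr1 -eps_sum mulr_sumr big1.
Qed.

Lemma neq0_eps a : a != 0 -> exists i, a * eps i != 0.
Proof.
move=> a0; apply/existsP; apply: contraR a0.
by rewrite negb_exists => /forallP h; apply/eqP/eps_separate => i; apply/eqP/negPn.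
Qed.

(** Both [eps j] and [sigma^d (eps i)] generate minimal ideals, which
    coincide as soon as they meet: an automorphism of [A] permutes the field
    factors. *)
Lemma iter_sigma_eps d i j :
  iter d sigma (eps i) * eps j != 0 -> iter d sigma (eps i) = eps j.
Proof.
have [e eE] := iter_sigma_onto d (eps j).
move=> /[dup] h; rewrite -eE -iter_sigmaM iter_sigma_eq0 mulrC => ne0.
have ee : e * e = e by apply: (@iter_sigma_inj d); rewrite iter_sigmaM eE.
have eq1 := idem_field ee ne0.
have ss : iter d sigma (eps i) * iter d sigma (eps i) = iter d sigma (eps i).
  by rewrite -iter_sigmaM epsK.
by rewrite eE -[RHS](idem_field ss h) -{1}eq1 iter_sigmaM eE mulrC.
Qed.

Lemma mulEE i j : E i * E j = E i *+ (i == j).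
Proof. by rewrite -skewCM epsM; case: eqP => //; rewrite skewC0. Qed.

Lemma mulEEid i : E i * E i = E i.
Proof. by rewrite mulEE eqxx. Qed.

Lemma sumE : \sum_i E i = 1 :> S.
Proof. by rewrite -skewC_sum eps_sum. Qed.

Lemma comp_sum f : f = \sum_i E i * f.
Proof. by rewrite -mulr_suml sumE mul1r. Qed.

Lemma comp_sumr f : f = \sum_i f * E i.
Proof. by rewrite -mulr_sumr sumE mulr1. Qed.

(** The coefficients of a component live, degree by degree, in a single field
    factor of [A]; the highest one is therefore supported on one [eps m]. *)
Lemma comp_coef k h d : E k * h = h -> skew_coef h d != 0 ->
  exists2 m, iter d sigma (eps k) = eps m & skew_coef h d * eps m = skew_coef h d.
Proof.
move=> hE h0; have hd : skew_coef h d = iter d sigma (eps k) * skew_coef h d.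
  by rewrite -{1}hE skew_coefCM.
have [m hm] := neq0_eps h0.
have em : iter d sigma (eps k) = eps m.
  apply: iter_sigma_eps; apply: contra_neq hm => z.
  by rewrite hd mulrAC z mul0r.
by exists m; rewrite // mulrC -em -hd.
Qed.

Lemma right_coef i h d : h * E i = h -> skew_coef h d * eps i = skew_coef h d.
Proof. by move=> hE; rewrite -{2}hE skew_coefMC. Qed.

Lemma iter_sigma_mul_neq0 d k m a b : iter d sigma (eps k) = eps m ->
  a * eps k != 0 -> b * eps m != 0 -> iter d sigma a * b != 0.
Proof.
move=> km ak bm; apply/eqP => ab0; have [c cE] := eps_field bm.
have: iter d sigma (a * eps k) == 0; last by rewrite iter_sigma_eq0 (negPf ak).
rewrite iter_sigmaM km -cE; apply/eqP.
by rewrite mulrCA [X in _ * X]mulrA ab0 mul0r mulr0.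
Qed.

(** Degrees add up although [A[z;sigma]] has zero divisors, since the relevant
    coefficients are multiplied in one field. *)
Lemma comp_mul_lead k f h : f * E k = f -> E k * h = h -> f != 0 -> h != 0 ->
  skew_coef (f * h) ((ssize f).-1 + (ssize h).-1) != 0.
Proof.
move=> fE hE f0 h0; rewrite (@skew_coefM_top _ _ _ _ (ssize f).-1 (ssize h).-1)
  ?leqSpred //.
have [m km hm] := comp_coef hE (skew_lead_neq0 h0).
apply: (iter_sigma_mul_neq0 km); first by rewrite (right_coef _ fE) skew_lead_neq0.
by rewrite hm skew_lead_neq0.
Qed.

Lemma comp_ssizeM k f h : f * E k = f -> E k * h = h -> f != 0 -> h != 0 ->
  ssize (f * h) = (ssize f + ssize h).-1.
Proof.
move=> fE hE f0 h0; apply/eqP; rewrite eqn_leq ssizeM_leq /=.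
have := skew_coef_neq0 (comp_mul_lead fE hE f0 h0).
move: f0 h0; rewrite -!ssize_eq0 -!lt0n; lia.
Qed.

(** ** Division and torsion *)

(** The leading coefficient of [h] is invertible in the field [A * eps i], to
    which the coefficients of [y] belong as well. *)
Lemma right_division i h y : h != 0 -> h * E i = h -> y * E i = y ->
  exists q, (ssize (y - q * h)%R < ssize h)%N.
Proof.
move=> h0 hE; have hs : (0 < ssize h)%N by rewrite lt0n ssize_eq0.
elim: (ssize y) {-2}y (leqnn (ssize y)) => [|n IH] {}y yn yE.
  by exists 0; rewrite mul0r subr0 (leq_ltn_trans yn).
have [yh|hy] := ltnP (ssize y) (ssize h); first by exists 0; rewrite mul0r subr0.
set nu := (ssize h).-1; set t := (ssize y).-1.
have hnu : skew_coef h nu * eps i = skew_coef h nu by apply: right_coef.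
have [b bE] : exists b, b * (skew_coef h nu * eps i) = eps i.
  by apply: eps_field; rewrite hnu skew_lead_neq0.
have [a aE] := iter_sigma_onto nu (skew_coef y t * b).
pose q1 : S := Z ^+ (t - nu) * C a.
have tnu : (nu <= t)%N by rewrite /nu /t -!subn1 leq_sub2r.
have [q qP] : exists q, (ssize ((y - q1 * h) - q * h)%R < ssize h)%N.
  apply: IH; last by rewrite mulrBl yE -mulrA hE.
  apply/ssize_leP => k nk; rewrite skew_coefB skew_coefZCM.
  have tk : (t <= k)%N by rewrite /t; lia.
  rewrite ltnNge (leq_trans (leq_subr _ _) tk) /=.
  have [->|tk'] := eqVneq k t.
    by rewrite subKn // aE -mulrA -hnu bE (right_coef _ yE) subrr.
  have ltk : (t < k)%N by rewrite ltn_neqAle eq_sym tk'.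
  rewrite [skew_coef y k]nth_default ?[skew_coef h _]nth_default ?mulr0 ?subr0 //.
    by rewrite -/(ssize h) /nu in tnu *; lia.
  by rewrite -/(ssize y); move: ltk; rewrite /t; lia.
by exists (q1 + q); rewrite mulrDl opprD addrA.
Qed.

(** Modulo [h] the powers of [z] have only finitely many remainders, so two of
    them agree. *)
Lemma torsion (T : finType) (c : A -> T) i h : injective c ->
  h != 0 -> h * E i = h ->
  exists s t q, (s < t)%N /\ (Z ^+ s - Z ^+ t) * E i = q * h.
Proof.
move=> c_inj h0 hE.
pose N := #|{ffun 'I_(ssize h) -> T}|.
have /fin_all_exists[q qP] : forall s : 'I_N.+1,
    exists q, (ssize (Z ^+ s * E i - q * h)%R < ssize h)%N.
  move=> s; apply: (@right_division i) => //.
  by rewrite -mulrA mulEEid.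
pose w (s : 'I_N.+1) := [ffun k : 'I_(ssize h) =>
  c (skew_coef (Z ^+ s * E i - q s * h) k)].
have /injectivePn[s [t st wst]] : ~~ injectiveb w.
  apply/negP => /injectiveP/leq_card; rewrite card_ord.
  by rewrite -/N ltnn.
have rE : Z ^+ s * E i - q s * h = Z ^+ t * E i - q t * h.
  apply: skew_ext => k; have [kh|hk] := ltnP k (ssize h).
    by move/ffunP: wst => /(_ (Ordinal kh)); rewrite !ffunE => /c_inj.
  by rewrite /skew_coef !nth_default // (leq_trans (ltnW (qP _)) hk).
wlog lt : s t st wst rE / (s < t)%N.
  move=> W; have [|ts|/val_inj /eqP] := ltngtP s t; last by rewrite (negPf st).
    exact: W.
  by apply: (W t s) => //; rewrite eq_sym.
exists s, t, (q s - q t); split=> //.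
rewrite !mulrBl -[Z ^+ s * E i](subrK (q s * h)) rE.
by rewrite addrAC [_ - _ - _]addrAC subrr add0r addrC.
Qed.

(** ** Reduction of a component by units *)

Lemma two_sided_unitM (u v : S) :
  two_sided_unit u -> two_sided_unit v -> two_sided_unit (u * v).
Proof.
move=> [u' [uu' u'u]] [v' [vv' v'v]]; exists (v' * u'); split.
  by rewrite mulrA -(mulrA u) vv' mulr1.
by rewrite mulrA -(mulrA v') u'u mulr1.
Qed.

Lemma transvection_unit (c : S) : c * c = 0 -> two_sided_unit (1 - c).
Proof.
move=> cc; exists (1 + c); split.
  by rewrite mulrBl !mulrDr !mul1r mulr1 cc addr0 addrK.
by rewrite mulrBr !mulrDl !mulr1 mul1r cc addr0 addrK.
Qed.

(** One step of Euclid's algorithm between the entries [h * E i] and [h * E j].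
    Both entries lie in [E l * A[z;sigma]], so the difference d of their degrees
    satisfies sigma^d (eps i) = eps j, and a multiple of z^d reaches the [j]-th
    entry from the [i]-th. *)
Lemma cancel_lead l h i j : E l * h = h -> i != j ->
  h * E i != 0 -> h * E j != 0 -> (ssize (h * E i)%R <= ssize (h * E j)%R)%N ->
  exists c : S, [/\ E i * c = c, c * E j = c
    & (ssize (h * E j - h * c)%R < ssize (h * E j)%R)%N].
Proof.
move=> hE ij hi0 hj0 le.
set e := (ssize (h * E i)).-1; set t := (ssize (h * E j)).-1.
have et : (e <= t)%N by rewrite /e /t -!subn1 leq_sub2r.
set b := skew_coef (h * E i) e; set b' := skew_coef (h * E j) t.
have bE : b * eps i = b by apply: right_coef; rewrite -mulrA mulEEid.
have bE' : b' * eps j = b' by apply: right_coef; rewrite -mulrA mulEEid.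
have b0 : b != 0 by apply: skew_lead_neq0.
have b0' : b' != 0 by apply: skew_lead_neq0.
(* the left component of [h] forces [sigma^(t - e)] to map [eps i] to [eps j] *)
have lE k s : skew_coef (h * E k) s != 0 -> iter s sigma (eps l) = eps k.
  move=> ne; apply: iter_sigma_eps; apply: contra_neq ne => z.
  by rewrite -hE -mulrA skew_coefCM skew_coefMC mulrCA z mulr0.
have dE : iter (t - e) sigma (eps i) = eps j.
  by rewrite -(lE i e b0) -iterD subnK // (lE j t b0').
have sb : iter (t - e) sigma b * eps j = iter (t - e) sigma b.
  by rewrite -dE -iter_sigmaM bE.
(* [Z ^+ (t - e) * C a] is chosen so that its product with the leading term of
   [h * E i] is the leading term of [h * E j] *)
have [x xE] : exists x, x * (iter (t - e) sigma b * eps j) = eps j.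
  by apply: eps_field; rewrite sb iter_sigma_eq0.
pose a := x * b'; have aE : a * eps j = a by rewrite /a -mulrA bE'.
have cE : E i * (Z ^+ (t - e) * C a) = Z ^+ (t - e) * C a.
  by rewrite mulrA skewC_CZ dE -mulrA -skewCM [eps j * _]mulrC aE.
exists (Z ^+ (t - e) * C a); split=> //; first by rewrite -mulrA -skewCM aE.
have -> : h * (Z ^+ (t - e) * C a) = (h * E i) * (Z ^+ (t - e) * C a).
  by rewrite -mulrA cE.
have js : (0 < ssize (h * E j)%R)%N by rewrite lt0n ssize_eq0.
rewrite -(prednK js) ltnS -/t; apply/ssize_leP => k tk.
rewrite skew_coefB skew_coefMZC ltnNge (leq_trans (leq_subr _ _) tk) /=.
have [->|kt] := eqVneq k t.
  by rewrite subKn // -/b -/b' mulrCA -sb mulrA xE mulrC bE' subrr.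
have lt : (t < k)%N by rewrite ltn_neqAle eq_sym kt.
rewrite [skew_coef (h * E j) k]nth_default; last first.
  by rewrite -/(ssize _); move: lt; rewrite /t; lia.
rewrite [skew_coef (h * E i) _]nth_default ?iter_sigma0 ?mul0r ?subr0 //.
by rewrite -/(ssize _); move: lt et; rewrite /e; lia.
Qed.

(** Right multiplication by the unit [1 - c] of the previous step only changes
    the entry at [j], so the sum of the sizes of the entries decreases until a
    single entry is left. *)
Lemma concentrate l h : E l * h = h -> h != 0 ->
  exists V i, two_sided_unit V /\ h * V * E i = h * V.
Proof.
have [n] := ubnP (\sum_i ssize (h * E i)%R)%N; elim: n h => // n IH h hn hE h0.
have [i hi0] : exists i, h * E i != 0.
  apply/existsP; apply: contraR h0; rewrite negb_exists => /forallP all0.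
  by rewrite (comp_sumr h) big1 // => i _; apply/eqP/negPn.
have [hi|hi] := eqVneq (h * E i) h.
  by exists 1, i; rewrite mulr1 hi; split=> //; exists 1; rewrite mulr1.
have [j /andP[ij hj0]] : exists j, (i != j) && (h * E j != 0).
  apply/existsP; apply: contraR hi; rewrite negb_exists => /forallP all0.
  rewrite {2}(comp_sumr h) (bigD1 i) //= big1 ?addr0 // => j ji.
  by have := all0 j; rewrite eq_sym ji /= => /negPn/eqP.
wlog le : i j ij hi0 hj0 {hi} / (ssize (h * E i)%R <= ssize (h * E j)%R)%N.
  move=> W; have [le|/ltnW le] := leqP (ssize (h * E i)) (ssize (h * E j)).
    exact: (W i j).
  by apply: (W j i) => //; rewrite eq_sym.
have [c [ic cj clt]] := cancel_lead hE ij hi0 hj0 le.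
have cc : c * c = 0.
  by rewrite -{1}cj -ic -mulrA [E j * _]mulrA mulEE eq_sym (negPf ij) mul0r mulr0.
have cE k : k != j -> c * E k = 0.
  by move=> kj; rewrite -cj -mulrA mulEE eq_sym (negPf kj) mulr0.
have hV k : k != j -> h * (1 - c) * E k = h * E k.
  by move=> kj; rewrite -mulrA mulrBl cE // mul1r subr0.
have hVj : h * (1 - c) * E j = h * E j - h * c.
  by rewrite -mulrA mulrBl cj mul1r mulrBr.
have [||| V [m [Vu VE]]] := IH (h * (1 - c)).
- rewrite -ltnS (leq_trans _ hn) // ltnS [ltnRHS](bigD1 j) //= [ltnLHS](bigD1 j) //= hVj.
  rewrite -addSn leq_add // leq_eqVlt; apply/orP; left; apply/eqP.
  by apply: eq_bigr => k kj; rewrite hV.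
- by rewrite mulrA hE.
- by apply: contraNneq hi0 => z; rewrite -hV // z mul0r.
exists ((1 - c) * V), m; split; last by rewrite mulrA VE.
by apply: two_sided_unitM => //; apply: transvection_unit.
Qed.

(** Saturation with respect to the binomials z^s - z^t, the polynomials that
    [torsion] produces. *)
Definition z_saturated (I : set S) : Prop :=
  forall s t f, (s < t)%N -> I ((Z ^+ s - Z ^+ t) * f) -> I f.

(** After concentration, [g] becomes [h] with [E l * h = h * E i = h], and
    saturation makes [E i] a left multiple of [h]. By degrees [h] is then a
    constant, a nonzero element of the field [A * eps l], which 1 - [eps l]
    completes to a unit of [A]. *)
Lemma saturated_component_unit (T : finType) (c : A -> T) l g : injective c ->
  E l * g = g -> g != 0 -> z_saturated (left_principal g) ->
  exists u : S, two_sided_unit u /\ g = E l * u.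
Proof.
move=> c_inj gE g0 gsat.
have [V [i [[V' [VV' V'V]] VE]]] := concentrate gE g0.
set h := g * V in VE.
have gh : g = h * V' by rewrite -mulrA VV' mulr1.
have hE : E l * h = h by rewrite mulrA gE.
have h0 : h != 0 by apply: contraNneq g0 => z; rewrite gh z mul0r.
have [s [t [q [st qE]]]] := torsion c_inj h0 VE.
have [f _ fE] : left_principal g (E i * V').
  by apply: (gsat s t) => //; exists q => //; rewrite mulrA qE gh mulrA.
have {}fE : f * E l * h = E i.
  by rewrite -mulrA hE mulrA fE -mulrA V'V mulr1.
have f0 : f * E l != 0.
  by apply: contraTneq (skewC_neq0 sigma (eps_neq0 i)) => z; rewrite -fE z mul0r eqxx.
have := @comp_ssizeM l (f * E l) h; rewrite -mulrA mulEEid fE.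
move=> /(_ erefl hE f0 h0); rewrite /ssize size_polyC eps_neq0 => szE.
have hC : h = C (skew_coef h 0).
  apply: size1_polyC; move: szE (f0) (h0); rewrite -!ssize_eq0 /ssize; lia.
set a := skew_coef h 0 in hC.
have a0 : a != 0 by apply: contraNneq h0 => z; rewrite hC z skewC0.
have ai : a * eps i = a by apply: right_coef.
have al : eps l * a = a by rewrite /a -{2}hE skew_coefCM.
have il : i = l.
  apply/eqP; apply: contraNT a0 => il; rewrite -ai -al mulrAC epsM [l == i]eq_sym.
  by rewrite (negPf il) mul0r.
have [b bE] : exists b, b * (a * eps l) = eps l.
  by apply: eps_field; rewrite -il ai.
have {}bE : b * a = eps l by rewrite -bE mulrC [_ * eps l]mulrC al mulrC.
pose w := a + (1 - eps l); pose w' := b * eps l + (1 - eps l).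
have ww : w * w' = 1.
  have -> : w * w' = b * a * eps l + (a - eps l * a)
     + b * (eps l - eps l * eps l) + (1 - eps l - eps l + eps l * eps l).
    by rewrite /w /w'; ring.
  by rewrite bE al epsK; ring.
exists (C w * V'); split.
  apply: two_sided_unitM; last by exists V.
  by exists (C w'); rewrite -!skewCM [w' * w]mulrC ww.
have wE : eps l * w = a.
  by rewrite mulrDr al mulrBr mulr1 epsK subrr addr0.
by rewrite mulrA -skewCM wE -hC.
Qed.

(** ** Components of a reduced polynomial *)

Lemma comp_mulE k f : E k * skew_comp eps f k = skew_comp eps f k.
Proof. by rewrite mulrA mulEEid. Qed.

Lemma comp_LM k m h : E k * h = h -> h != 0 ->
  iter (ssize h).-1 sigma (eps k) = eps m ->
  is_LM eps h (monomial sigma eps (ssize h).-1 m).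
Proof.
move=> hE h0 km; have top := skew_lead_neq0 h0.
have hm : eps m * skew_coef h (ssize h).-1 = skew_coef h (ssize h).-1.
  by have := skew_coefCM h (eps k) (ssize h).-1; rewrite hE km => <-.
exists (ssize h).-1, m; split=> //; first by rewrite hm.
move=> nu l nz; have [nuE|nuN] := eqVneq nu (ssize h).-1.
  left; rewrite nuE in nz *; congr (_, _); apply/eqP; apply: contraNT nz => lm.
  by rewrite -hm mulrA epsM (negPf lm) mul0r.
right; apply/orP; left; rewrite ltn_neqAle nuN /= -ltnS prednK ?lt0n ?ssize_eq0 //.
by apply: skew_coef_neq0; apply: contraNneq nz => ->; rewrite mulr0.
Qed.

(** If two leading monomials end with the same idempotent, the one of lower
    degree right divides the other, because [sigma] is onto. *)
Lemma reduced_lead_distinct g k l m : reduced eps g ->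
  skew_comp eps g k != 0 -> skew_comp eps g l != 0 ->
  iter (ssize (skew_comp eps g k)).-1 sigma (eps k) = eps m ->
  iter (ssize (skew_comp eps g l)).-1 sigma (eps l) = eps m -> k = l.
Proof.
move=> gred k0 l0 km lm; apply/eqP; apply/negPn/negP => kl.
wlog le : k l k0 l0 km lm kl /
    ((ssize (skew_comp eps g k)).-1 <= (ssize (skew_comp eps g l)).-1)%N.
  move=> W; case/orP: (leq_total (ssize (skew_comp eps g k)).-1
                                 (ssize (skew_comp eps g l)).-1).
    exact: (W k l).
  by apply: (W l k) => //; rewrite eq_sym.
have LM := comp_LM (comp_mulE k g) k0 km.
set gl := skew_comp eps g l in l0 lm le; set mu := (ssize gl).-1 in lm le.
have top : eps m * skew_coef gl mu = skew_coef gl mu.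
  by rewrite -lm -skew_coefCM comp_mulE.
have lk : l != k by rewrite eq_sym.
apply: (gred l k _ lk k0 LM mu m).
  rewrite /skew_term -/gl top; apply: contraNneq (skew_lead_neq0 l0) => z.
  by have := skew_coefZC sigma mu (skew_coef gl mu) mu; rewrite z eqxx mulr1n skew_coef0 => <-.
rewrite /skew_term -/gl; set muk := (ssize _).-1 in LM le *.
have [a aE] := iter_sigma_onto muk (skew_coef gl mu).
exists (Z ^+ (mu - muk) * C a); rewrite /monomial.
by rewrite -[RHS]mulrA [C a * _]mulrA skewC_CZ -mulrA -skewCM aE mulrA -exprD
  subnK // [eps m * _]mulrC.
Qed.

Lemma product_top k f g : f * skew_comp eps g k != 0 ->
  exists m,
    iter (ssize (skew_comp eps g k)).-1 sigma (eps k) = eps m /\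
    let d := (ssize (f * skew_comp eps g k)).-1 in
    skew_coef (f * skew_comp eps g k) d * eps m
      = skew_coef (f * skew_comp eps g k) d.
Proof.
set gk := skew_comp eps g k => x0; set mu := (ssize gk).-1.
have gE : E k * gk = gk by apply: comp_mulE.
have xE : f * gk = (f * E k) * gk by rewrite -mulrA gE.
have g0 : gk != 0 by apply: contraNneq x0 => ->; rewrite mulr0.
have f0 : f * E k != 0 by apply: contraNneq x0 => z; rewrite xE z mul0r.
have fE : f * E k * E k = f * E k by rewrite -mulrA mulEEid.
have [m km mE] := comp_coef gE (skew_lead_neq0 g0); exists m; split=> //=.
rewrite xE (comp_ssizeM fE gE f0 g0).
have -> : (ssize (f * E k)%R + ssize gk).-1.-1 = ((ssize (f * E k)%R).-1 + mu)%N.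
  by move: f0 g0; rewrite -!ssize_eq0 /mu; lia.
by rewrite skew_coefM_top ?leqSpred // -mulrA mE.
Qed.

(** Different components of a reduced polynomial have leading monomials with
    different idempotents, hence so do their left multiples: nothing cancels in
    the highest degree. *)
Lemma reduced_independent g (f : 'I_r -> S) : reduced eps g ->
  \sum_k f k * skew_comp eps g k = 0 -> forall k, f k * skew_comp eps g k = 0.
Proof.
move=> gred sum0 k; apply/eqP; apply/negPn/negP => xk.
set x := fun k => f k * skew_comp eps g k.
have := @arg_maxnP _ k (fun k => x k != 0) (fun k => ssize (x k)) xk.
move=> [k0 x0 kmax]; have [m [k0m topm]] := product_top x0.
rewrite -/(x k0) /= in topm; set d := (ssize (x k0)).-1 in topm.
case/negP: (skew_lead_neq0 x0); rewrite -/d -topm.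
have: skew_coef (\sum_k x k) d * eps m = 0 by rewrite sum0 skew_coef0 mul0r.
rewrite skew_coef_sum mulr_suml (bigD1 k0) //= big1 ?addr0 => [->//|l lk].
apply/eqP; apply: contraNT lk => ne.
have cl0 : skew_coef (x l) d != 0 by apply: contraNneq ne => ->; rewrite mul0r.
have xl0 : x l != 0 by apply: contraNneq cl0 => ->; rewrite skew_coef0.
have dE : d = (ssize (x l)).-1.
  by have := skew_coef_neq0 cl0; have := kmax l xl0; rewrite /d; lia.
have [m' [lm' topm']] := product_top xl0.
rewrite -/(x l) /= -dE in topm'.
apply/eqP; apply: (reduced_lead_distinct gred _ _ lm'); last first.
- rewrite k0m; congr eps; apply/eqP; apply: contraNT ne => mm.
  by rewrite -topm' -mulrA epsM [m' == m]eq_sym (negPf mm) mulr0.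
- by apply: contraNneq x0 => z; rewrite /x z mulr0.
- by apply: contraNneq xl0 => z; rewrite /x z mulr0.
Qed.

(** This is what makes the left ideal of one component a direct summand. *)
Lemma reduced_multiple g f f' l : reduced eps g ->
  f * g = f' * skew_comp eps g l -> forall k, k != l -> f * skew_comp eps g k = 0.
Proof.
move=> gred fg k kl.
have := @reduced_independent g (fun k => if k == l then f - f' else f) gred.
rewrite (bigD1 l) //= eqxx => /(_ _ k); rewrite (negPf kl); apply.
under eq_bigr => j jl do rewrite (negPf jl).
have gsum : f * g =
    f * skew_comp eps g l + \sum_(j | j != l) f * skew_comp eps g j.
  by rewrite {1}(comp_sum g) mulr_sumr (bigD1 l).
by rewrite mulrBl addrAC -gsum fg subrr.
Qed.

Lemma mul_single_comp f g l :
  (forall k, k != l -> f * skew_comp eps g k = 0) -> f * g = f * skew_comp eps g l.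
Proof.
move=> fg0; rewrite {1}(comp_sum g) mulr_sumr (bigD1 l) //=.
by rewrite big1 ?addr0.
Qed.

Lemma single_comp g l :
  (forall k, k != l -> skew_comp eps g k = 0) -> skew_comp eps g l = g.
Proof.
move=> g0; rewrite -[RHS]mul1r (@mul_single_comp 1 g l) ?mul1r // => k kl.
by rewrite g0 ?mulr0.
Qed.

Lemma neq0_comp g : g != 0 -> exists l, skew_comp eps g l != 0.
Proof.
move=> g0; apply/existsP; apply: contraR g0; rewrite negb_exists => /forallP all0.
by rewrite (comp_sum g) big1 // => i _; apply/eqP/negPn/all0.
Qed.

End Components.

(** * Convolutional codes as saturated submodules *)

Section ConvolutionalCodes.
Context (F : fieldType).

(** The intrinsic form of a direct summand of the free module F[z]^n: its
    quotient has no torsion. *)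
Definition saturated_submodule n (D : set 'rV[{poly F}]_n) : Prop :=
  [/\ D 0, forall v w, D v -> D w -> D (v + w),
      forall p v, D v -> D (p *: v)
    & forall p v, p != 0 -> D (p *: v) -> D v].

(** Euclid's algorithm: column operations replace the other entries by their
    remainders modulo a chosen nonzero entry, and a nonzero remainder is a
    smaller choice. *)
Lemma row_to_axis n (v : 'rV[{poly F}]_n) : v != 0 ->
  exists V j d, [/\ V \in unitmx, d != 0 & v *m V = d *: delta_mx 0 j].
Proof.
move=> v0; have [i vi0] : exists i, v 0 i != 0.
  apply/existsP; apply: contraR v0; rewrite negb_exists => /forallP all0.
  by apply/eqP/rowP => i; rewrite mxE; apply/eqP/negPn.
have [N] := ubnP (size (v 0 i)); elim: N v i vi0 {v0} => // N IH v i vi0 vN.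
pose q : 'rV[{poly F}]_n := \row_j if j == i then 0 else v 0 j %/ v 0 i.
pose M := delta_mx i (0 : 'I_1) *m q.
have MM : M *m M = 0.
  have -> : M *m M = delta_mx i 0 *m (q *m delta_mx i (0 : 'I_1)) *m q.
    by rewrite /M !mulmxA.
  have -> : q *m delta_mx i (0 : 'I_1) = 0; last by rewrite mulmx0 mul0mx.
  by rewrite -colE; apply/matrixP => a b; rewrite !mxE eqxx.
have U : (1%:M - M) \in unitmx.
  suff /mulmx1_unit[] : (1%:M - M) *m (1%:M + M) = 1%:M by [].
  by rewrite mulmxBl !mulmxDr !mul1mx mulmx1 MM addr0 addrK.
have vE j : (v *m (1%:M - M)) 0 j = if j == i then v 0 i else v 0 j %% v 0 i.
  rewrite mulmxBr mulmx1 /M mulmxA -colE !mxE big_ord1 !mxE.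
  case: eqP => [->|_]; first by rewrite mulr0 subr0.
  by rewrite {1}(divp_eq (v 0 j) (v 0 i)) mulrC addrC addKr.
have [/existsP[j /andP[ji nz]]|] :=
    boolP [exists j, (j != i) && (v 0 j %% v 0 i != 0)].
  have vj := vE j; rewrite (negPf ji) in vj.
  have [||V [k [d [Vu d0 VE]]]] := IH (v *m (1%:M - M)) j.
  - by rewrite vj.
  - by rewrite vj (leq_trans _ (vN : (_ <= N)%N)) // ltn_modp.
  by exists ((1%:M - M) *m V), k, d; rewrite unitmx_mul U Vu mulmxA.
rewrite negb_exists => /forallP all0.
exists (1%:M - M), i, (v 0 i); split=> //; apply/rowP => j.
rewrite vE !mxE eqxx /=; case: eqP => [|/eqP ji]; first by rewrite mulr1.
by have := all0 j; rewrite ji mulr0 => /negPn/eqP.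
Qed.

(** A right inverse of the generator matrix recovers the message, so that a
    factor can be removed from it. *)
Lemma conv_code_saturated n (D : set 'rV[{poly F}]_n) :
  conv_code D -> saturated_submodule D.
Proof.
move=> [k [G [[H GH] ->]]]; split.
- by exists 0; rewrite ?mul0mx.
- by move=> _ _ [u _ <-] [w _ <-]; exists (u + w); rewrite ?mulmxDl.
- by move=> p _ [u _ <-]; exists (p *: u); rewrite ?scalemxAl.
move=> p v p0 [u _ uE]; exists (v *m H) => //.
have : p *: (v *m H *m G) = p *: v.
  by rewrite scalemxAl scalemxAl -uE -(mulmxA u) GH mulmx1.
move/eqP; rewrite -subr_eq0 -scalerBr => /eqP/rowP z; apply/eqP.
rewrite -subr_eq0; apply/eqP/rowP => i; have /eqP := z i.
by rewrite !mxE mulf_eq0 (negPf p0) => /eqP.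
Qed.

(** After a change of basis a nonzero row becomes a multiple of a basis vector,
    which lies in the submodule by saturation and splits off. *)
Lemma saturated_conv_code n (D : set 'rV[{poly F}]_n) :
  saturated_submodule D -> conv_code D.
Proof.
elim: n D => [|n IH] D Dsat; have [D0 DD DZ Dp] := Dsat.
  exists 0, 0; split; first by exists 0; rewrite [LHS]flatmx0 [RHS]flatmx0.
  apply/seteqP; split=> v _; last by rewrite [v]thinmx0.
  by exists 0; rewrite // [RHS]thinmx0 mulmx0.
have [D0'|] := pselect (forall v, D v -> v = 0).
  exists 0, 0; split; first by exists 0; rewrite [LHS]flatmx0 [RHS]flatmx0.
  apply/seteqP; split=> [v /D0' ->|_ [u _ <-]]; first by exists 0; rewrite ?mulmx0.
  by rewrite mulmx0.
move=> /existsNP[v /not_implyP[Dv /eqP v0]].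
have [V [j [d [Vu d0 VE]]]] := row_to_axis v0.
pose W := V *m tperm_mx j ord0.
have Wu : W \in unitmx by rewrite unitmx_mul Vu unitmx_perm.
have WE : v *m W = d *: delta_mx 0 ord0.
  rewrite mulmxA VE -scalemxAl; congr (_ *: _).
  by apply/rowP => k; rewrite -rowE !mxE tpermL eq_sym.
have e0E : delta_mx 0 ord0 = row_mx 1%:M 0 :> 'rV[{poly F}]_(1 + n).
  apply/rowP => k; rewrite !mxE eqxx; case: splitP => k' kE.
    by rewrite ord1 mxE /= -val_eqE /= kE ord1.
  by rewrite mxE -val_eqE /= kE.
pose Wi : 'M[{poly F}]_(1 + n, n.+1) := invmx W.
have WK (w : 'rV_n.+1) : w *m W *m Wi = w by rewrite mulmxK.
have WiW : Wi *m W = 1%:M by rewrite /Wi mulVmx.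
have De0 : D (row_mx 1%:M 0 *m Wi).
  by apply: (Dp d) => //; rewrite -e0E scalemxAl -WE WK.
pose D2 : set 'rV[{poly F}]_n := [set w | D (row_mx 0 w *m Wi)].
have DE w : D (w *m Wi) <-> D2 (rsubmx (w : 'rV_(1 + n))).
  have wE : w = lsubmx (w : 'rV_(1 + n)) 0 0 *: row_mx 1%:M 0
              + row_mx 0 (rsubmx (w : 'rV_(1 + n))).
    rewrite scale_row_mx scaler0 add_row_mx addr0 add0r -[LHS]hsubmxK.
    by congr row_mx; rewrite scalemx1 -mx11_scalar.
  have wE' : w *m Wi = lsubmx (w : 'rV_(1 + n)) 0 0 *: (row_mx 1%:M 0 *m Wi)
              + row_mx 0 (rsubmx (w : 'rV_(1 + n))) *m Wi.
    by rewrite {1}wE mulmxDl scalemxAl.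
  split=> [Dw|D2w]; last first.
    rewrite wE'; exact: (DD _ _ (DZ _ _ De0) D2w).
  rewrite /D2 /= -[X in D X](addKr (lsubmx (w : 'rV_(1 + n)) 0 0
    *: (row_mx 1%:M 0 *m Wi))) -wE' -scaleNr.
  by apply: DD => //; apply: DZ.
have [|k [G [[H GH] D2E]]] := IH D2.
  split; rewrite /D2 /=.
  - by rewrite row_mx0 mul0mx.
  - move=> u w Du Dw; rewrite -[X in row_mx X _](addr0 0) -add_row_mx mulmxDl.
    exact: DD.
  - by move=> p w Dw; rewrite -[X in row_mx X _](scaler0 _ p) -scale_row_mx
      -scalemxAl; apply: DZ.
  - move=> p w p0; rewrite -[X in row_mx X (p *: w)](scaler0 _ p) -scale_row_mx.
    by rewrite -scalemxAl; apply: Dp.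
pose G1 : 'M[{poly F}]_(1 + k, 1 + n) := block_mx 1%:M 0 0 G.
pose H1 : 'M[{poly F}]_(1 + n, 1 + k) := block_mx 1%:M 0 0 H.
have GH1 : G1 *m H1 = 1%:M.
  rewrite /G1 /H1 mulmx_block GH.
  by rewrite !mulmx0 !mul0mx !mulmx1 !addr0 !add0r -scalar_mx_block.
exists (1 + k)%N, (G1 *m Wi); split.
  by exists (W *m H1); rewrite mulmxA -(mulmxA G1) WiW mulmx1 [LHS]GH1.
apply/seteqP; split=> [w Dw|_ [u _ <-]].
  have Dw' : D (w *m W *m Wi) by rewrite WK.
  have : D2 (rsubmx (w *m W : 'rV_(1 + n))) by exact: (DE _).1 Dw'.
  rewrite D2E => -[u _ uE].
  exists (row_mx (lsubmx (w *m W : 'rV_(1 + n))) u) => //.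
  rewrite mulmxA mul_row_block !mulmx0 mulmx1 addr0 add0r uE.
  by rewrite (hsubmxK (w *m W : 'rV_(1 + n))); exact: WK.
rewrite mulmxA; apply: (DE _).2; rewrite D2E; exists (rsubmx u) => //.
by rewrite -{2}[u]hsubmxK mul_row_block row_mxKr !mulmx0 add0r.
Qed.

End ConvolutionalCodes.

(** * Field decomposition of the cyclic algebra *)

Section CyclicAlgebra.
Context (F : fieldType) (n : nat).
Context (n_gt0 : (0 < n)%N).
Local Notation A := (cyclic_alg F n).
Local Notation Xn1 := ('X^n - 1 : {poly F}).

Lemma mk_monic_cyclic : mk_monic Xn1 = Xn1.
Proof.
by rewrite /mk_monic monicXnsubC // size_XnsubC // ltnS n_gt0.
Qed.

Lemma size_cyclic (a : A) : (size (a : {poly F}) <= n)%N.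
Proof.
by rewrite -ltnS (leq_trans (size_mk_monic a)) // mk_monic_cyclic size_XnsubC.
Qed.

Section Residues.
Context (r : nat) (pi : 'I_r -> {poly F}).
Context (pi_monic : forall i, pi i \is monic).
Context (pi_irr : forall i, irreducible_poly (pi i)).
Context (pi_inj : injective pi).
Context (pi_prod : 'X^n - 1 = \prod_(i < r) pi i).

Let res (a : A) j := (a : {poly F}) %% pi j.

Lemma pi_coprime i j : i != j -> coprimep (pi i) (pi j).
Proof.
move=> ij; have [//|nc] := boolP (coprimep (pi i) (pi j)).
have gi := pi_irr i _ nc (dvdp_gcdl _ _).
have gj := pi_irr j _ nc (dvdp_gcdr _ _).
case/eqP: ij; apply: pi_inj; apply/eqP; rewrite -eqp_monic //.
by apply: eqp_trans gj; rewrite eqp_sym.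
Qed.

Lemma pi_dvd_cyclic j : pi j %| Xn1.
Proof. by rewrite pi_prod (bigD1 j) //= dvdp_mulr. Qed.

Lemma residue_mod p j : (in_qpoly Xn1 p : {poly F}) %% pi j = p %% pi j.
Proof.
rewrite /= mk_monic_cyclic -Pdiv.IdomainMonic.modpE ?monicXnsubC //.
rewrite [in RHS](divp_eq p Xn1) modpD.
have /modp_eq0P -> : pi j %| p %/ Xn1 * Xn1 by rewrite dvdp_mull // pi_dvd_cyclic.
by rewrite add0r.
Qed.

Lemma residueM a b j : res (a * b) j = ((a : {poly F}) * b) %% pi j.
Proof. exact: residue_mod. Qed.

Lemma prod_dvdp (s : seq 'I_r) p : uniq s -> (forall j, pi j %| p) ->
  \prod_(i <- s) pi i %| p.
Proof.
move=> + dv; elim: s => [|i s IH]; first by rewrite big_nil dvd1p.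
rewrite big_cons /= => /andP[iNs us]; rewrite Gauss_dvdp ?dv ?IH //.
rewrite big_seq; elim/big_rec: _ => [|j q js]; first exact: coprimep1.
rewrite coprimepMr pi_coprime //; by apply: contraNneq iNs => ->.
Qed.

(** Injectivity in the Chinese remainder theorem. *)
Lemma residue_inj a b : (forall j, res a j = res b j) -> a = b.
Proof.
move=> ab; apply/eqP; rewrite -subr_eq0; apply/eqP/val_inj => /=.
have dv j : pi j %| (a : {poly F}) - b.
  by rewrite /dvdp modpD modpN -/(res a j) ab subrr.
have := prod_dvdp (index_enum_uniq _) dv; rewrite -pi_prod => dvX.
apply/eqP; apply/negPn/negP => nz.
have := dvdp_leq nz dvX; rewrite size_XnsubC // ltnNge => /negP; apply.
exact: (size_cyclic (a - b)).
Qed.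

(** All identities can be tested modulo each [pi j]. An element that is a
    nonzero multiple of [eps i] vanishes modulo the other factors, hence not
    modulo [pi i], and a Bezout relation with [pi i] inverts it. *)
Lemma primitive_idempotents_decompose (eps : 'I_r -> A) :
  primitive_idempotents pi eps -> field_decomposition eps.
Proof.
move=> epsP.
have resE k j : res (eps k) j = (k == j)%:R %% pi j.
  apply/eqP; rewrite -subr_eq0 -modpN -modpD; exact: epsP.
have res1 j : 1 %% pi j = 1 :> {poly F}.
  by rewrite modp_small // size_poly1; case: (pi_irr j).
have resE' k j : res (eps k) j = (k == j)%:R.
  by rewrite resE; case: (k == j); rewrite ?res1 ?mod0p.
have resME a k j : res (a * eps k) j = if k == j then res a j else 0.
  rewrite residueM -modp_mul -/(res (eps k) j) resE'.
  by case: (k == j); rewrite ?mulr1 ?mulr0 ?mod0p.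
have res0 j : res 0 j = 0 by rewrite /res mod0p.
split.
- move=> i j; apply: residue_inj => k; rewrite resME resE'.
  have [->|ij] := eqVneq i j; first by rewrite resE'; case: (j == k).
  rewrite res0; have [<-|//] := eqVneq j k; first by rewrite (negPf ij).
- apply: residue_inj => k; rewrite /res poly_of_qpoly_sum.
  rewrite (bigD1 k) //= modpD -/(res (eps k) k) resE' eqxx.
  rewrite (_ : _ %% _ = 0) ?addr0 ?qpolyCE ?res1 //.
  apply: modp_eq0; elim/big_ind: _ => [|? ?|i ik]; rewrite ?dvdp0 //.
    exact: dvdp_add.
  by rewrite /dvdp -/(res (eps i) k) resE' (negPf ik).
- move=> i; apply/eqP => z; have := resE' i i; rewrite z res0 eqxx.
  by move/eqP; rewrite eq_sym oner_eq0.
move=> i a; set c := a * eps i => c0.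
have resc j : j != i -> res c j = 0.
  by move=> ji; rewrite resME eq_sym (negPf ji).
have cop : coprimep (pi i) c.
  rewrite irreducible_poly_coprime //; apply: contra c0 => dv.
  apply/eqP/residue_inj => j; rewrite res0; have [->|ji] := eqVneq j i.
    exact/eqP.
  exact: resc.
have [[u v] /= uv] := Bezout_eq1_coprimepP _ _ cop.
exists (in_qpoly Xn1 v); apply: residue_inj => j.
rewrite residueM mulrC -modp_mul residue_mod modp_mul resE'.
have [<-|ji] := eqVneq i j.
  have: (u * pi i + v * c) %% pi i = 1 by rewrite uv res1.
  by rewrite modpD modp_mull add0r mulrC.
rewrite mulrC -modp_mul -/(res c j) resc 1?eq_sym // mulr0 mod0p //.
Qed.

End Residues.
End CyclicAlgebra.

(** * Rows of polynomials as skew polynomials *)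

Section Transport.
Context (F : fieldType) (n : nat).
Context (n_gt0 : (0 < n)%N).
Local Notation A := (cyclic_alg F n).
Context (sigma : {lrmorphism A -> A}).
Local Notation S := (skewpoly sigma).
Local Notation Z := (skewZ sigma).
Implicit Types (v w : 'rV[{poly F}]_n) (C : set 'rV[{poly F}]_n).

Lemma row_to_algE (v : 'rV[F]_n) : row_to_alg v = rVpoly v :> {poly F}.
Proof.
by rewrite in_qpoly_small // mk_monic_cyclic // size_XnsubC // ltnS size_poly.
Qed.

Lemma row_to_algD (v w : 'rV[F]_n) :
  row_to_alg (v + w) = row_to_alg v + row_to_alg w.
Proof. by rewrite /row_to_alg linearD in_qpolyD. Qed.

Lemma row_to_algZ c (v : 'rV[F]_n) : row_to_alg (c *: v) = c *: row_to_alg v.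
Proof. by rewrite /row_to_alg linearZ /= in_qpolyZ. Qed.

Lemma row_to_alg0 : row_to_alg (0 : 'rV[F]_n) = 0.
Proof. by rewrite /row_to_alg linear0 in_qpoly0. Qed.

Lemma row_to_alg_inj : injective (@row_to_alg F n).
Proof.
by move=> v w /(congr1 (fun a : A => a : {poly F})); rewrite !row_to_algE
  => /(can_inj (@rVpolyK _ _)).
Qed.

Lemma poly_rV_algK (a : A) : row_to_alg (poly_rV (a : {poly F}) : 'rV_n) = a.
Proof.
by apply: val_inj; rewrite [LHS]row_to_algE poly_rV_K ?size_cyclic.
Qed.

(** For finite F this embeds the coefficient algebra into a finite type. *)
Lemma alg_row_inj : injective (fun a : A => poly_rV (a : {poly F}) : 'rV_n).
Proof. exact: can_inj poly_rV_algK. Qed.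

Lemma coef_to_skew v j : skew_coef (to_skew sigma v) j = row_to_alg (coef_row j v).
Proof.
rewrite /to_skew skew_coef_sum.
under eq_bigr do rewrite skew_coefZC.
have [jm|mj] := ltnP j (\max_(i < n) size (v 0%R i)).
  rewrite (bigD1 (Ordinal jm)) //= eqxx big1 ?addr0 // => k kj.
  by rewrite -(inj_eq val_inj) /= eq_sym in kj; rewrite (negPf kj).
rewrite big1 => [|k _]; last by rewrite gtn_eqF // (leq_trans (ltn_ord k) mj).
rewrite (_ : coef_row j v = 0) ?row_to_alg0 //; apply/rowP => i.
by rewrite !mxE nth_default // (leq_trans _ mj) // leq_bigmax.
Qed.

Lemma to_skewD v w : to_skew sigma (v + w) = to_skew sigma v + to_skew sigma w.
Proof.
apply: skew_ext => j; rewrite skew_coefD !coef_to_skew -row_to_algD.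
by congr row_to_alg; apply/rowP => i; rewrite !mxE coefD.
Qed.

Lemma to_skew0 : to_skew sigma 0 = 0.
Proof. by apply: (@addrI _ (to_skew sigma 0)); rewrite -to_skewD !addr0. Qed.

Lemma to_skewN v : to_skew sigma (- v) = - to_skew sigma v.
Proof. by apply/eqP; rewrite -addr_eq0 -to_skewD addNr to_skew0. Qed.

Lemma to_skew_inj : injective (to_skew sigma).
Proof.
move=> v w vw; apply/rowP => i; apply/polyP => j.
have := congr1 (fun f => skew_coef f j) vw; rewrite !coef_to_skew.
by move=> /row_to_alg_inj/rowP/(_ i); rewrite !mxE.
Qed.

Lemma to_skew_surj (f : S) : exists v, to_skew sigma v = f.
Proof.
exists (\row_i \poly_(j < ssize f) (poly_rV (skew_coef f j : {poly F}) : 'rV_n) 0 i).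
apply: skew_ext => j; rewrite coef_to_skew -[RHS]poly_rV_algK; congr row_to_alg.
apply/rowP => i; rewrite mxE mxE coef_poly; case: ltnP => // fj.
by rewrite /skew_coef nth_default // linear0 mxE.
Qed.

Lemma to_skewC (c : F) v :
  to_skew sigma (c%:P *: v) = skewC sigma c%:A * to_skew sigma v.
Proof.
apply: skew_ext => j; rewrite skew_coefCM !coef_to_skew.
(* the scalars are fixed because [sigma] is F-linear *)
have -> : iter j sigma c%:A = c%:A :> A.
  by elim: j => //= j ->; rewrite linearZ /= rmorph1.
rewrite -scalerAl mul1r -row_to_algZ; congr row_to_alg.
by apply/rowP => i; rewrite !mxE coefCM.
Qed.

Lemma to_skewXn d v : to_skew sigma ('X^d *: v) = Z ^+ d * to_skew sigma v.
Proof.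
apply: skew_ext => j; have -> : Z ^+ d = Z ^+ d * skewC sigma 1 by rewrite mulr1.
rewrite skew_coefZCM !coef_to_skew iter_sigma1 mul1r.
have [jd|dj] := ltnP j d.
  rewrite (_ : coef_row j _ = 0) ?row_to_alg0 //; apply/rowP => i.
  by rewrite !mxE coefXnM jd.
by congr row_to_alg; apply/rowP => i; rewrite !mxE coefXnM ltnNge dj.
Qed.

(** The multiplier is [p] itself, read in the subring F[z] of A[z;sigma]. *)
Lemma to_skewZ (p : {poly F}) :
  exists q : S, forall v, to_skew sigma (p *: v) = q * to_skew sigma v.
Proof.
elim/poly_ind: p => [|p c [q qE]].
  by exists 0 => v; rewrite scale0r to_skew0 mul0r.
exists (q * Z + skewC sigma c%:A) => v.
have := to_skewXn 1 v; rewrite !expr1 => XE.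
by rewrite scalerDl to_skewD -scalerA qE XE to_skewC mulrDl mulrA.
Qed.

Lemma to_skew_scale_eq0 (p : {poly F}) q v : p != 0 ->
  (forall w, to_skew sigma (p *: w) = q * to_skew sigma w) ->
  q * to_skew sigma v = 0 -> to_skew sigma v = 0.
Proof.
move=> p0 pq; rewrite -pq -to_skew0 => /to_skew_inj pv.
rewrite (_ : v = 0) //; apply/rowP => i; move/rowP/(_ i)/eqP: pv.
by rewrite !mxE mulf_eq0 (negPf p0) => /eqP.
Qed.

Lemma conv_code_z_saturated C : conv_code C -> z_saturated (to_skew sigma @` C).
Proof.
move=> /conv_code_saturated[_ _ _ Cp] s t f st [w Cw wE].
have [v vE] := to_skew_surj f; exists v => //.
apply: (Cp ('X^s - 'X^t)).
  rewrite subr_eq0; apply/eqP => /(congr1 (fun p : {poly F} => size p)).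
  by rewrite !size_polyXn => -[/eqP]; rewrite ltn_eqF.
rewrite (_ : _ *: v = w) //; apply: to_skew_inj.
by rewrite wE scalerBl to_skewD to_skewN !to_skewXn vE mulrBl.
Qed.

End Transport.

(** * Minimal cyclic codes *)

(** For a nonzero element [f * g] of the subcode, torsion writes
    [(z^s - z^t) * g] as a left multiple of [f * g]; saturation removes the
    binomial. *)
Lemma component_no_subcode (F : finFieldType) (n : nat) (n_gt0 : (0 < n)%N)
  (r : nat) (eps : 'I_r -> cyclic_alg F n)
  (sigma : {lrmorphism cyclic_alg F n -> cyclic_alg F n}) (k : 'I_r)
  (g : skewpoly sigma) (C D : set 'rV[{poly F}]_n) :
  field_decomposition eps -> bijective sigma -> g = skew_comp eps g k ->
  to_skew sigma @` C = left_principal g ->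
  cyclic_code sigma D -> D <> [set 0] -> D `<=` C -> D = C.
Proof.
move=> eps_dec sigma_bij gE CE [Dcode Did] D0 DC.
have [_ _ IM] := Did.
have [D00 _ _ _] := conv_code_saturated Dcode.
have [w Dw w0] : exists2 w, D w & w != 0.
  apply: contrapT => no; apply: D0; apply/seteqP; split=> [w Dw|_ -> //].
  by apply/eqP/negPn/negP => w0; apply: no; exists w.
have [f _ fE] : left_principal g (to_skew sigma w).
  by rewrite -CE; exists w => //; apply: DC.
have f0 : f * skewC sigma (eps k) != 0.
  apply: contra_neq w0 => z; apply: (to_skew_inj n_gt0 (sigma := sigma)).
  by rewrite -fE gE /skew_comp mulrA z mul0r to_skew0.
have [s [t [q [st qE]]]] : exists s t q, (s < t)%N /\
    (skewZ sigma ^+ s - skewZ sigma ^+ t) * skewC sigma (eps k)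
      = q * (f * skewC sigma (eps k)).
  apply: (torsion eps_dec sigma_bij (alg_row_inj n_gt0)) => //.
  by rewrite -mulrA mulEEid.
have Dg : (to_skew sigma @` D) g.
  apply: (conv_code_z_saturated n_gt0 Dcode st).
  rewrite {1}gE /skew_comp mulrA qE -!mulrA -/(skew_comp eps g k) -gE fE.
  by apply: IM; exists w.
apply/seteqP; split=> // v Cv.
have [h _ hE] : left_principal g (to_skew sigma v) by rewrite -CE; exists v.
have [v' Dv' v'E] := IM h g Dg.
by rewrite -(to_skew_inj n_gt0 (etrans v'E hE)).
Qed.

(** By independence of the components of a reduced [g], the left ideal generated
    by one of them is a direct summand of the one generated by [g]; being
    saturated is inherited by direct summands. *)
Lemma component_subcode (F : fieldType) (n : nat) (n_gt0 : (0 < n)%N)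
  (r : nat) (eps : 'I_r -> cyclic_alg F n)
  (sigma : {lrmorphism cyclic_alg F n -> cyclic_alg F n}) (l : 'I_r)
  (g : skewpoly sigma) (C : set 'rV[{poly F}]_n) :
  field_decomposition eps -> bijective sigma -> conv_code C -> generator_poly eps C g ->
  cyclic_code sigma
    [set v | left_principal (skew_comp eps g l) (to_skew sigma v)].
Proof.
move=> eps_dec sigma_bij Ccode [gred CE].
set D := [set v | _].
have DE v : D v <-> exists f, to_skew sigma v = f * skew_comp eps g l.
  by split=> [[f _ <-]|[f fE]]; exists f.
have DC : D `<=` C.
  move=> v /DE[f fE].
  have [w Cw wE] : (to_skew sigma @` C) (to_skew sigma v).
    by rewrite CE; exists (f * skewC sigma (eps l)); rewrite // fE mulrA.
  by rewrite -(to_skew_inj n_gt0 wE).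
have [_ _ _ Cp] := conv_code_saturated Ccode.
split; last first.
  split.
  - by exists 0; rewrite ?to_skew0 //; apply/DE; exists 0; rewrite mul0r to_skew0.
  - move=> _ _ [v /DE[f fE] <-] [w /DE[h hE] <-].
    exists (v + w); last by rewrite to_skewD.
    by apply/DE; exists (f + h); rewrite to_skewD // fE hE mulrDl.
  move=> h _ [v /DE[f fE] <-]; have [w wE] := to_skew_surj n_gt0 (h * to_skew sigma v).
  by exists w => //; apply/DE; exists (h * f); rewrite wE fE mulrA.
apply: saturated_conv_code; split.
- by apply/DE; exists 0; rewrite mul0r to_skew0.
- move=> v w /DE[f fE] /DE[h hE].
  by apply/DE; exists (f + h); rewrite to_skewD // fE hE mulrDl.
- move=> p v /DE[f fE]; have [q qE] := to_skewZ sigma p.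
  by apply/DE; exists (q * f); rewrite qE fE mulrA.
move=> p v p0 /[dup] /DC /(Cp _ _ p0) Cv /DE[f' f'E].
have [f _ fE] : left_principal g (to_skew sigma v) by rewrite -CE; exists v.
have [q qE] := to_skewZ sigma p.
rewrite qE -fE mulrA in f'E.
(* only the [l]-th component of [p *: v] survives, hence also that of [v] *)
have qf0 := reduced_multiple eps_dec sigma_bij gred f'E.
apply/DE; exists f; rewrite -fE; apply: (mul_single_comp eps_dec) => k kl.
have [w wE] := to_skew_surj n_gt0 (f * skew_comp eps g k).
rewrite -wE.
by apply: (to_skew_scale_eq0 n_gt0 p0 qE); rewrite wE mulrA qf0.
Qed.

Theorem proposition3p2 (F : finFieldType) (n : nat)
  (n_gt0 : (0 < n)%N) (n_coprime : coprime n #|F|)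
  (r : nat) (pi : 'I_r -> {poly F})
  (pi_monic : forall i, pi i \is monic)
  (pi_irr : forall i, irreducible_poly (pi i))
  (pi_inj : injective pi)
  (pi_prod : 'X^n - 1 = \prod_(i < r) pi i)
  (pi_sorted : forall i j : 'I_r, (i <= j)%N -> (size (pi i) <= size (pi j))%N)
  (eps : 'I_r -> cyclic_alg F n) (eps_idem : primitive_idempotents pi eps)
  (sigma : {lrmorphism cyclic_alg F n -> cyclic_alg F n})
  (sigma_bij : bijective sigma)
  (C : set 'rV[{poly F}]_n) (C_cyclic : cyclic_code sigma C)
  (g : skewpoly sigma) (g_gen : generator_poly eps C g) :
  [<-> minimal_code sigma eps C;
       C <> [set 0] /\
         (forall D : set 'rV[{poly F}]_n, cyclic_code sigma D ->
            D <> [set 0] -> D `<=` C -> D = C);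
       exists (u : skewpoly sigma) (l : 'I_r),
         two_sided_unit u /\ g = skew_comp eps u l].
Proof.
have eps_dec :=
  primitive_idempotents_decompose n_gt0 pi_monic pi_irr pi_inj pi_prod eps_idem.
have [gred CE] := g_gen; have [Ccode _] := C_cyclic.
have [C00 _ _ _] := conv_code_saturated Ccode.
tfae.
- move=> [_ C0 [g' [_ CE'] [k g'E]]]; split=> // D.
  exact: component_no_subcode eps_dec sigma_bij g'E CE'.
- move=> [C0 minC].
  have Cprin v : C v -> exists f, to_skew sigma v = f * g.
    move=> Cv; suff [f _ <-] : left_principal g (to_skew sigma v) by exists f.
    by rewrite -CE; exists v.
  have g0 : g != 0.
    apply/eqP => z; apply: C0; apply/seteqP; split=> [v|_ -> //].
    move=> /Cprin[f]; rewrite z mulr0 -(to_skew0 sigma).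
    by move=> /(to_skew_inj n_gt0) ->.
  have [l gl0] := neq0_comp eps_dec g0.
  have [v vE] := to_skew_surj n_gt0 (skew_comp eps g l).
  pose D : set 'rV[{poly F}]_n :=
    [set v | left_principal (skew_comp eps g l) (to_skew sigma v)].
  have DC : D = C.
    apply: minC.
    + exact: (component_subcode n_gt0 l eps_dec sigma_bij Ccode g_gen).
    + move=> D0; have : D v by rewrite /D /= vE; exact: left_principal_id.
      by rewrite D0 => v0; case/eqP: gl0; rewrite -vE v0 to_skew0.
    + move=> w [f _ fE].
      have [w' Cw' w'E] : (to_skew sigma @` C) (to_skew sigma w).
        by rewrite CE; exists (f * skewC sigma (eps l)); rewrite // -fE mulrA.
      by rewrite -(to_skew_inj n_gt0 w'E).
  have [w Cw wE] : (to_skew sigma @` C) g by rewrite CE; exact: left_principal_id.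
  have [f _ fE] : D w by rewrite DC.
  have glE : skew_comp eps g l = g.
    apply: (single_comp eps_dec) => k kl; rewrite -[LHS]mul1r.
    apply: (reduced_multiple eps_dec sigma_bij gred _ kl (f' := f)).
    by rewrite mul1r fE wE.
  have gsat : z_saturated (left_principal g).
    by rewrite -CE; apply: conv_code_z_saturated.
  have [u [uU uE]] :=
    saturated_component_unit eps_dec sigma_bij (alg_row_inj n_gt0) glE g0 gsat.
  by exists u, l.
move=> [u [l [[u' [uu' _]] gE]]].
have gl : g = skew_comp eps g l by rewrite gE /skew_comp mulrA mulEEid.
have [_ _ eps_neq0 _] := eps_dec.
split=> //; last by exists g => //; exists l.
move=> C0; have [w] : (to_skew sigma @` C) g by rewrite CE; exact: left_principal_id.
rewrite C0 => -> /esym; rewrite to_skew0 gE => z.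
have /eqP[] := skewC_neq0 sigma (eps_neq0 l).
by rewrite -[LHS]mulr1 -uu' mulrA -/(skew_comp eps u l) z mul0r.
Qed.
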